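(* Let $D$ be an integral domain and $\star$ a semistar operation on $D$. The following are equivalent: (1) $D$ is a $\star$-Dedekind domain ($\star$-DD). (2) $D$ is $\tilde\star$-Noetherian, $\tilde\star\text{-}\dim(D)=1$ and $D$ is quasi-$\tilde\star$-integrally closed. (3) $D$ is $\tilde\star$-Noetherian, $\tilde\star\text{-}\dim(D)=1$ and $D^{\tilde\star}$ is integrally closed.
   Context: Let $D$ be an integral domain with quotient field $K$. $\overline{\boldsymbol F}(D)$ denotes the set of all nonzero $D$-submodules of $K$, and $\boldsymbol f(D)$ the set of nonzero finitely generated $D$-submodules of $K$. For $E,F\in\overline{\boldsymbol F}(D)$, $(E:F)=\{z\in K: zF\subseteq E\}$. A semistar operation on $D$ is a map $\star:\overline{\boldsymbol F}(D)\to\overline{\boldsymbol F}(D)$, $E\mapsto E^\star$, such that for all $0\neq x\in K$ and $E,F\in\overline{\boldsymbol F}(D)$: $(xE)^\star=xE^\star$; $E\subseteq F$ implies $E^\star\subseteq F^\star$; $E\subseteq E^\star$ and $(E^\star)^\star=E^\star$. The semistar operation $\star_f$ is defined by $E^{\star_f}:=\bigcup\{F^\star : F\in\boldsymbol f(D),\ F\subseteq E\}$. A quasi-$\star$-ideal of $D$ is a nonzero ideal $I$ of $D$ with $I=I^\star\cap D$; a quasi-$\star$-prime is a nonzero prime ideal that is a quasi-$\star$-ideal. $\mathcal{M}(\star_f)$ is the set of quasi-$\star_f$-maximal ideals, i.e. the maximal elements of the set of proper quasi-$\star_f$-ideals (these are prime). The semistar operation $\tilde\star$ is defined by $E^{\tilde\star}:=\bigcap\{ED_Q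 : Q\in\mathcal{M}(\star_f)\}$ (an empty intersection being $K$). $D$ is $\star$-Noetherian if it has the ascending chain condition on quasi-$\star$-ideals. A nonzero ideal $I$ is $\star$-invertible if $(I(D:I))^\star=D^\star$. $D$ is a P$\star$MD if each nonzero finitely generated ideal of $D$ is $\star_f$-invertible. $D$ is a $\star$-Dedekind domain ($\star$-DD) if it is $\star$-Noetherian and a P$\star$MD. For a quasi-$\star$-prime $P$, the $\star$-height of $P$ is the supremum of the lengths of the chains of quasi-$\star$-primes between $(0)$ (included) and $P$, i.e. chains $(0)\subsetneq P_1\subsetneq\cdots\subsetneq P_n=P$ with all $P_i$ quasi-$\star$-primes have length $n$; $\star\text{-}\dim(D)$ is the supremum of the $\star$-heights of the quasi-$\star$-primes of $D$ (and is $0$ if there are none). $D^{[\star]}:=\bigcup\{(F^\star:F^\star) : F\in\boldsymbol f(D)\}$, and $D$ is quasi-$\star$-integrally closed if $D^\star=D^{[\star]}$. All these notions are applied also with $\tilde\star$ in place of $\star$.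
   Formalization: The formal theorem additionally assumes that D^⋆ ≠ K (so in particular D is not a field); if D^⋆ = K, then (1) always holds while ⋆̃-dim(D) = 0, so (2) and (3) fail. *)

(* Defs.v *)
From HB Require Import structures.
From mathcomp Require Import all_boot all_order all_algebra fraction.
From mathcomp Require Import boolp classical_sets constructive_ereal.

Set Implicit Arguments.
Unset Strict Implicit.
Unset Printing Implicit Defensive.

Import Order.TTheory GRing.Theory Num.Theory.

Local Open Scope classical_set_scope.
Local Open Scope ring_scope.

(* [D] is identified with its image [base D] in K = {fraction D}; ideals of [D]
   are D-submodules of K contained in [base D]. *)
Section Semistar.
Variable D : idomainType.
Notation K := {fraction D}.
Implicit Types (E F I J P Q R : set K) (star : set K -> set K).

Definition base : set K := range (@tofrac D).

Definition submodule E : Prop :=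
  [/\ E 0,
      forall x y, E x -> E y -> E (x + y)
    & forall (a : D) x, E x -> E (tofrac a * x)].

Definition Fbar E : Prop := submodule E /\ exists2 x, E x & x != 0.

Definition Dspan (s : seq K) : set K :=
  [set z | exists c : 'I_(size s) -> D, z = \sum_i tofrac (c i) * s`_i].

Definition finitely_generated E : Prop := exists s : seq K, E = Dspan s.

Definition fgFbar E : Prop := Fbar E /\ finitely_generated E.

Definition scale (x : K) E : set K := [set x * y | y in E].

Definition colon E F : set K := [set z | scale z F `<=` E].

Definition prodm E F : set K :=
  [set z | exists n (a b : 'I_n -> K),
    [/\ forall i, E (a i), forall i, F (b i) & z = \sum_i a i * b i]].

(* A semistar operation is a self-map of [Fbar]; it is represented by a function
   on all subsets of K, whose values outside [Fbar] are irrelevant. *)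
Record semistar star : Prop := Semistar {
  semistar_Fbar : forall E, Fbar E -> Fbar (star E);
  semistar_scale : forall (x : K) E, x != 0 -> Fbar E ->
    star (scale x E) = scale x (star E);
  semistar_mono : forall E F, Fbar E -> Fbar F -> E `<=` F -> star E `<=` star F;
  semistar_ext : forall E, Fbar E -> E `<=` star E;
  semistar_idem : forall E, Fbar E -> star (star E) = star E
}.

Definition star_f star : set K -> set K :=
  fun E => \bigcup_(F in [set F | fgFbar F /\ F `<=` E]) star F.

Definition nonzero_ideal I : Prop := Fbar I /\ I `<=` base.

Definition quasi_ideal star I : Prop :=
  nonzero_ideal I /\ I = star I `&` base.

Definition prime_ideal P : Prop :=
  [/\ submodule P, P `<` base
    & forall x y, base x -> base y -> P (x * y) -> P x \/ P y].

Definition quasi_prime star P : Prop := prime_ideal P /\ quasi_ideal star P.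

Definition proper_quasi_ideal star I : Prop := quasi_ideal star I /\ I <> base.

Definition quasi_max star : set (set K) :=
  [set Q | proper_quasi_ideal star Q /\
     forall J, proper_quasi_ideal star J -> Q `<=` J -> J = Q].

Definition localization Q : set K :=
  [set z | exists a s : K, [/\ base a, base s, ~ Q s & z = a / s]].

Definition star_tilde star : set K -> set K :=
  fun E => \bigcap_(Q in quasi_max (star_f star)) prodm E (localization Q).

Definition star_noetherian star : Prop :=
  forall I : nat -> set K,
    (forall n, quasi_ideal star (I n)) ->
    (forall n, I n `<=` I n.+1) ->
    exists N, forall n, (N <= n)%N -> I n = I N.

Definition star_invertible star I : Prop :=
  star (prodm I (colon base I)) = star base.

Definition PstarMD star : Prop :=
  forall I, nonzero_ideal I -> finitely_generated I ->
    star_invertible (star_f star) I.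

Definition star_DD star : Prop := star_noetherian star /\ PstarMD star.

Definition chain_to star P (n : nat) : Prop :=
  exists C : nat -> set K,
    [/\ C 0%N = [set 0], C n = P,
        forall i, (0 < i <= n)%N -> quasi_prime star (C i)
      & forall i, (i < n)%N -> C i `<` C i.+1].

(* Heights and dimension are suprema of sets of natural numbers, taken in
   [\bar int] so that the value +oo is available; the first argument of
   [supremum] is the value on the empty set. *)
Definition star_height star P : \bar int :=
  supremum 0%E [set (n%:Z)%:E | n in [set n | chain_to star P n]].

Definition star_dim star : \bar int :=
  supremum 0%E [set star_height star P | P in [set P | quasi_prime star P]].

Definition star_closure_bracket star : set K :=
  \bigcup_(F in [set F | fgFbar F]) colon (star F) (star F).

Definition quasi_integrally_closed star : Prop :=
  star base = star_closure_bracket star.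

Definition quotient_field R : set K :=
  [set z | exists a b : K, [/\ R a, R b, b != 0 & z = a / b]].

Definition integral_over R (z : K) : Prop :=
  exists p : {poly K}, [/\ p \is monic, forall i, R p`_i & root p z].

Definition integrally_closed R : Prop :=
  forall z, quotient_field R z -> integral_over R z -> R z.

End Semistar.

Arguments base D : clear implicits.

(* Main.v *)
Require Import Defs.
From mathcomp Require Import all_boot all_order all_algebra fraction generic_quotient.
From mathcomp Require Import boolp classical_sets constructive_ereal.

(** Write f for [star_f star] and t for [star_tilde star]; M(f) is the set of
    quasi-f-maximal ideals, which are prime.  Membership in E^t is local:
    x lies in E^t iff for every Q in M(f) some s outside Q satisfies s x in E.

    (1) => (2).  If G is a nonzero finitely generated D-submodule of K and Q is
    in M(f), invertibility gives u in G and v in (D : G) with u v outside Q, so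
    that G D_Q = u D_Q.  Hence t = f, and the ACC on quasi-star-ideals passes to
    quasi-t-ideals.  If P is a nonzero prime contained in Q, x in Q \ P and
    0 <> y in P, then y / x^n is in P D_Q for all n, and the contractions to D
    of the modules (y / x^n) D_Q form a chain which cannot become stationary;
    so P = Q.

    (2) => (3).  If z is integral of degree n over D^t, then
    F = D + D z + ... + D z^(n-1) satisfies z F^t <= F^t.

    (3) => (1).  Let Q be in M(f) and 0 <> a in Q.  A maximal ideal among the
    (a D_Q : b) /\ D with b in D \ a D_Q is prime, hence equal to Q.  Then
    w = b / a is not in D_Q and w Q <= D_Q.  If w Q <= Q D_Q, all a w^n lie in
    D_Q, and the chain a (1, w, ..., w^n) D_Q shows that w is integral over D_Q,
    which is impossible; so some q w with q in Q is a unit of D_Q and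
    Q D_Q = q D_Q.  For I finitely generated, the largest n with I <= q^n D_Q
    yields an element of I (D : I) outside Q. *)

Set Implicit Arguments.
Unset Strict Implicit.
Unset Printing Implicit Defensive.

Import Order.TTheory GRing.Theory Num.Theory.

Section Theory.

Local Open Scope classical_set_scope.
Local Open Scope ring_scope.
Local Open Scope quotient_scope.

Variable D : idomainType.
Notation K := {fraction D}.
Notation B := (base D).
Implicit Types (E F G I J P Q R : set K) (star : set K -> set K).
Implicit Types (x y z : K) (l : seq K).

(** * Submodules of K and localizations *)

Lemma baseP (a : D) : B (tofrac a).
Proof. by exists a. Qed.

Lemma base1 : B 1.
Proof. by rewrite -tofrac1; apply: baseP. Qed.

Lemma submodule_base : submodule B.
Proof.
split; first by rewrite -tofrac0; apply: baseP.
- by move=> _ _ [a _ <-] [b _ <-]; rewrite -tofracD; apply: baseP.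
- by move=> a _ [b _ <-]; rewrite -tofracM; apply: baseP.
Qed.

Lemma base_den x : exists b, [/\ B b, b != 0 & B (b * x)].
Proof.
elim/quotW: x => r; exists (tofrac \d_r); split; first exact: baseP.
  by rewrite tofrac_eq0 denom_ratioP.
suff -> : tofrac \d_r * \pi_K r = tofrac \n_r by apply: baseP.
unlock FracField.tofrac; rewrite -[LHS]FracField.pi_mul; apply/eqmodP.
rewrite /= FracField.equivfE /FracField.mulf !numden_Ratio ?oner_neq0 ?mul1r ?denom_ratioP//.
by rewrite mulr1 mulrC.
Qed.

Lemma submodule0 E : submodule E -> E 0.
Proof. by case. Qed.

Lemma submoduleD E x y : submodule E -> E x -> E y -> E (x + y).
Proof. by case=> _ + _; apply. Qed.

Lemma submoduleM E a x : submodule E -> B a -> E x -> E (a * x).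
Proof. by case=> _ _ EM [b _ <-]; apply: EM. Qed.

Lemma submoduleN E x : submodule E -> E x -> E (- x).
Proof.
move=> hE Ex; rewrite -mulN1r; apply: submoduleM => //.
by rewrite -tofrac1 -tofracN; apply: baseP.
Qed.

Lemma submodule_sum E n (F : 'I_n -> K) :
  submodule E -> (forall i, E (F i)) -> E (\sum_i F i).
Proof.
move=> hE EF; apply: (big_ind E) => //; first exact: submodule0.
by move=> x y; apply: submoduleD.
Qed.

Lemma baseM x y : B x -> B y -> B (x * y).
Proof. exact: submoduleM submodule_base. Qed.

Lemma baseX x n : B x -> B (x ^+ n).
Proof.
move=> Bx; elim: n => [|n IH]; first by rewrite expr0; apply: base1.
by rewrite exprS; apply: baseM.
Qed.

Lemma submodule_preim E x : submodule E -> submodule [set z | E (z * x)].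
Proof.
move=> hE; split=> /= [|y z Ey Ez|a y Ey]; first by rewrite mul0r; apply: submodule0.
  by rewrite mulrDl; apply: submoduleD.
by rewrite -mulrA; apply: submoduleM => //; apply: baseP.
Qed.

Lemma submoduleI E F : submodule E -> submodule F -> submodule (E `&` F).
Proof.
move=> hE hF; split; first by split; apply: submodule0.
  by move=> x y [Ex Fx] [Ey Fy]; split; apply: submoduleD.
by move=> a x [Ex Fx]; split; apply: submoduleM => //; apply: baseP.
Qed.

Lemma Fbar_base : Fbar B.
Proof.
by split; [exact: submodule_base|exists 1; [exact: base1|exact: oner_neq0]].
Qed.

Lemma ideal_full I : submodule I -> I `<=` B -> I 1 -> I = B.
Proof.
move=> hI IB I1; rewrite eqEsubset; split=> // x Bx.
by rewrite -[x]mulr1; apply: submoduleM.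
Qed.

Lemma Fbar_sub E F : Fbar E -> submodule F -> E `<=` F -> Fbar F.
Proof. by move=> [_ [x Ex x0]] hF EF; split=> //; exists x => //; apply: EF. Qed.

Lemma Fbar_capB E : Fbar E -> Fbar (E `&` B).
Proof.
move=> [hE [x Ex x0]]; split; first exact: submoduleI submodule_base.
have [b [Bb b0 Bbx]] := base_den x.
by exists (b * x); [split=> //; apply: submoduleM|rewrite mulf_neq0].
Qed.

Lemma base_den_seq l :
  exists b, [/\ B b, b != 0 & {in l, forall x, B (b * x)}].
Proof.
elim: l => [|x l [b [Bb b0 bl]]].
  by exists 1; split; [exact: base1|exact: oner_neq0|].
have [c [Bc c0 Bcx]] := base_den x; exists (b * c); split.
- exact: baseM.
- by rewrite mulf_neq0.
move=> y; rewrite inE => /orP[/eqP ->|/bl By]; first by rewrite -mulrA; apply: baseM.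
by rewrite mulrAC mulrC; apply: baseM.
Qed.

Lemma submodule_Dspan l : submodule (Dspan l).
Proof.
split.
- exists (fun=> 0); rewrite big1 // => i _.
  by rewrite tofrac0 mul0r.
- move=> _ _ [c ->] [d ->]; exists (fun i => c i + d i).
  by rewrite -big_split; apply: eq_bigr => i _; rewrite tofracD mulrDl.
- move=> a _ [c ->]; exists (fun i => a * c i); rewrite mulr_sumr.
  by apply: eq_bigr => i _; rewrite tofracM mulrA.
Qed.

Lemma Dspan_mem l x : x \in l -> Dspan l x.
Proof.
move=> xl; have hi : (index x l < size l)%N by rewrite index_mem.
exists (fun i => (i == Ordinal hi)%:R).
rewrite (bigD1 (Ordinal hi)) //= eqxx big1 => [|i /negPf ->].
  by rewrite tofrac1 mul1r addr0 nth_index.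
by rewrite tofrac0 mul0r.
Qed.

Lemma Dspan_sub E l : submodule E -> {in l, forall x, E x} -> Dspan l `<=` E.
Proof.
move=> hE lE _ [c ->]; apply: submodule_sum => // i.
by apply: submoduleM => //; [exact: baseP|apply/lE/mem_nth].
Qed.

Lemma fgFbar_Dspan l x : x \in l -> x != 0 -> fgFbar (Dspan l).
Proof.
move=> xl x0; split; last by exists l.
by split; [exact: submodule_Dspan|exists x => //; exact: Dspan_mem].
Qed.

Lemma fgFbar_cons x F :
  fgFbar F -> exists G, [/\ fgFbar G, F `<=` G, G x &
    forall E, submodule E -> F `<=` E -> E x -> G `<=` E].
Proof.
move=> [[hF [y Fy y0]] [l Fl]]; exists (Dspan (x :: l)).
have FG : F `<=` Dspan (x :: l).
  rewrite Fl; apply: Dspan_sub; first exact: submodule_Dspan.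
  by move=> z zl; apply: Dspan_mem; rewrite inE zl orbT.
have hG := submodule_Dspan (x :: l); split=> //.
- by split; [split=> //; exists y => //; apply: FG|exists (x :: l)].
- by apply: Dspan_mem; rewrite mem_head.
move=> E hE FE Ex; apply: Dspan_sub => // z; rewrite inE => /orP[/eqP -> //|zl].
by apply: FE; rewrite Fl; apply: Dspan_mem.
Qed.

Lemma scale_Dspan x l : scale x (Dspan l) = Dspan [seq x * y | y <- l].
Proof.
rewrite eqEsubset; split=> [_ [y ly <-]|].
  rewrite mulrC.
  apply: (Dspan_sub (submodule_preim x (submodule_Dspan _))) ly => z zl /=.
  by apply: Dspan_mem; rewrite mulrC map_f.
apply: Dspan_sub => [|_ /mapP[y yl ->]]; last by exists y => //; apply: Dspan_mem.
have hl := submodule_Dspan l; split.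
- by exists 0; [exact: submodule0|rewrite mulr0].
- move=> _ _ [y ly <-] [z lz <-]; exists (y + z); last by rewrite mulrDr.
  exact: submoduleD.
- move=> a _ [y ly <-]; exists (tofrac a * y); last by rewrite mulrCA.
  by apply: submoduleM => //; exact: baseP.
Qed.

Lemma fgFbar_scale x F : x != 0 -> fgFbar F -> fgFbar (scale x F).
Proof.
move=> x0 [[_ [y Fy y0]] [l Fl]]; rewrite Fl in Fy *.
split; last by exists [seq x * y | y <- l]; rewrite scale_Dspan.
split; first by rewrite scale_Dspan; apply: submodule_Dspan.
by exists (x * y); [exists y|rewrite mulf_neq0].
Qed.

Lemma colonP E F z : colon E F z <-> forall x, F x -> E (z * x).
Proof.
split=> [h x Fx|h _ [x Fx <-]]; last exact: h.
by apply: h; exists x.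
Qed.

Lemma prodm_sub E F G : submodule G ->
  (forall x y, E x -> F y -> G (x * y)) -> prodm E F `<=` G.
Proof.
move=> hG EFG _ [n [a [b [Ea Fb ->]]]].
by apply: submodule_sum => // i; apply: EFG.
Qed.

Lemma prodm_mul E F x y : E x -> F y -> prodm E F (x * y).
Proof.
by move=> Ex Fy; exists 1%N, (fun=> x), (fun=> y); split=> //; rewrite big_ord1.
Qed.

Lemma submodule_prodm E F : submodule E -> submodule (prodm E F).
Proof.
move=> hE; split.
- exists 0%N, (fun=> 0), (fun=> 0).
  by split; [case|case|rewrite big_ord0].
- move=> _ _ [n [a [b [Ea Fb ->]]]] [m [c [d [Ec Fd ->]]]].
  pose h T (u : 'I_n -> T) (v : 'I_m -> T) i :=
    match split i with inl j => u j | inr j => v j end.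
  exists (n + m)%N, (h K a c), (h K b d); split.
  + by move=> i; rewrite /h; case: (split i).
  + by move=> i; rewrite /h; case: (split i).
  rewrite big_split_ord; congr (_ + _); apply: eq_bigr => i _; rewrite /h.
    by case: split_ordP => [j /lshift_inj <- //|j /eqP]; rewrite eq_lrshift.
  by case: split_ordP => [j /eqP|j /rshift_inj <- //]; rewrite eq_rlshift.
- move=> r _ [n [a [b [Ea Fb ->]]]]; exists n, (fun i => tofrac r * a i), b.
  split=> // [i|]; first by apply: submoduleM => //; apply: baseP.
  by rewrite mulr_sumr; apply: eq_bigr => i _; rewrite mulrA.
Qed.

(* The module E D_P, without the common denominators of [prodm E (localization P)]. *)
Definition loc P E : set K := [set z | exists s, [/\ B s, ~ P s & E (s * z)]].

Section Loc.
Variable P : set K.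
Hypothesis hP : prime_ideal P.

Lemma prime_submodule : submodule P. Proof. by case: hP. Qed.

Lemma prime_base : P `<=` B. Proof. by case: hP => _ []. Qed.

Lemma prime1 : ~ P 1.
Proof.
by case: hP => hs [PB BP] _ P1; apply: BP; rewrite (ideal_full hs PB P1).
Qed.

Lemma prime_notinM x y : B x -> ~ P x -> B y -> ~ P y -> B (x * y) /\ ~ P (x * y).
Proof.
by case: hP => _ _ h Bx Px By Py; split; [exact: baseM|case/(h _ _ Bx By)].
Qed.

Lemma notin_neq0 s : ~ P s -> s != 0.
Proof. by move=> Ps; apply/eqP => s0; apply: Ps; rewrite s0; case: prime_submodule. Qed.

Lemma submodule_loc E : submodule E -> submodule (loc P E).
Proof.
move=> hE; split.
- by exists 1; rewrite mulr0; split; [exact: base1|exact: prime1|case: hE].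
- move=> x y [s [Bs Ps Ex]] [t [Bt Pt Ey]]; exists (s * t).
  have [Bst Pst] := prime_notinM Bs Ps Bt Pt; split=> //.
  rewrite mulrDr; apply: submoduleD => //; last by rewrite -mulrA; apply: submoduleM.
  by rewrite mulrAC mulrC; apply: submoduleM.
- move=> a x [s [Bs Ps Ex]]; exists s; split=> //.
  by rewrite mulrCA; apply: submoduleM => //; apply: baseP.
Qed.

Lemma loc_ext E : E `<=` loc P E.
Proof. by move=> x Ex; exists 1; rewrite mul1r; split=> //; [exact: base1|exact: prime1]. Qed.

Lemma loc_mono E F : E `<=` F -> loc P E `<=` loc P F.
Proof. by move=> EF x [s [Bs Ps Ex]]; exists s; split=> //; apply: EF. Qed.

Lemma loc_idem E : loc P (loc P E) `<=` loc P E.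
Proof.
move=> x [s [Bs Ps [t [Bt Pt Ex]]]]; exists (t * s); rewrite -mulrA.
by have [] := prime_notinM Bt Pt Bs Ps.
Qed.

Lemma loc_mulr E x y : submodule E -> loc P E x -> loc P B y -> loc P E (x * y).
Proof.
move=> hE [s [Bs Ps Ex]] [t [Bt Pt By]]; exists (s * t).
have [Bst Pst] := prime_notinM Bs Ps Bt Pt; split=> //.
by rewrite mulrACA mulrC; apply: submoduleM.
Qed.

Lemma prodm_localization E : submodule E -> prodm E (localization P) = loc P E.
Proof.
move=> hE; rewrite eqEsubset; split=> [|x [s [Bs Ps Ex]]].
  apply: prodm_sub => [|x _ Ex [a [s [Ba Bs Ps ->]]]]; first exact: submodule_loc.
  exists s; split=> //; have s0 := notin_neq0 Ps.
  by rewrite mulrCA [a / s]mulrC (mulVKf s0) mulrC; apply: submoduleM.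
rewrite -[x](mulKf (notin_neq0 Ps)) mulrC; apply: prodm_mul => //.
by exists 1, s; rewrite mul1r; split=> //; apply: base1.
Qed.

Lemma loc_den_seq E l : submodule E -> {in l, forall x, loc P E x} ->
  exists s, [/\ B s, ~ P s & {in l, forall x, E (s * x)}].
Proof.
move=> hE; elim: l => [_|x l IH hl].
  by exists 1; split=> //; [exact: base1|exact: prime1].
have [z zl|s [Bs Ps sl]] := IH; first by apply: hl; rewrite inE zl orbT.
have [t [Bt Pt tx]] := hl x (mem_head _ _); exists (s * t).
have [Bst Pst] := prime_notinM Bs Ps Bt Pt; split=> // y.
rewrite inE => /orP[/eqP ->|/sl yl]; first by rewrite -mulrA; apply: submoduleM.
by rewrite mulrAC mulrC; apply: submoduleM.
Qed.

End Loc.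

(** * Semistar operations *)

(** Without a maximal member, dependent choice yields a strictly ascending chain in [S]. *)
Lemma acc_max (op : set K -> set K) (S : set (set K)) I :
  star_noetherian op -> S `<=` quasi_ideal op -> S I ->
  exists2 M, S M & forall J, S J -> M `<=` J -> J = M.
Proof.
move=> acc Sq SI; apply: contrapT => noMax.
have next (M : {M | S M}) : exists J : {J | S J}, sval M `<` sval J.
  apply: contrapT => h; apply: noMax; exists (sval M); first exact: svalP.
  move=> J SJ MJ; apply: contrapT => JM; apply: h; exists (exist _ J SJ).
  by split=> // JM'; apply: JM; rewrite eqEsubset.
have [g gP] := choice next.
pose A n := iter n g (exist _ I SI).
have [n|n|N hN] := acc (fun n => sval (A n)).
- exact/Sq/svalP.
- exact: (gP (A n)).1.
by case: (gP (A N)) => _; apply; have := hN _ (leqnSn N); rewrite /= => ->.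
Qed.

Variable star : set K -> set K.
Hypothesis hstar : semistar star.
Notation f := (star_f star).
Notation t := (star_tilde star).

Lemma submodule_star E : Fbar E -> submodule (star E).
Proof. by move/(semistar_Fbar hstar) => []. Qed.

Lemma star_sub E F : Fbar E -> Fbar F -> E `<=` star F -> star E `<=` star F.
Proof.
move=> hE hF EF; rewrite -(semistar_idem hstar hF).
by apply: (semistar_mono hstar) => //; apply: (semistar_Fbar hstar).
Qed.

Lemma star_f_elim E z : f E z -> exists F, [/\ fgFbar F, F `<=` E & star F z].
Proof. by move=> [F [hF FE] sF]; exists F. Qed.

Lemma star_f_intro E F z : fgFbar F -> F `<=` E -> star F z -> f E z.
Proof. by move=> hF FE sF; exists F. Qed.

Lemma star_f_mono E F : E `<=` F -> f E `<=` f F.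
Proof. by move=> EF z [G [hG GE] sG]; exists G => //; split=> // u /GE /EF. Qed.

Lemma star_f_fg F : fgFbar F -> f F = star F.
Proof.
move=> hF; rewrite eqEsubset; split=> z; last exact: star_f_intro.
case/star_f_elim=> G [[hG _] GF]; apply: (semistar_mono hstar) => //; exact: hF.1.
Qed.

(** The finitely generated modules inside E are directed, so one of them serves all of [l]; this
    makes [f E] a submodule and [f] idempotent. *)
Lemma star_f_Dspan E l : Fbar E -> {in l, forall x, f E x} ->
  exists F, [/\ fgFbar F, F `<=` E & {in l, forall x, star F x}].
Proof.
move=> [hE [e Ee e0]]; elim: l => [_|x l IH hl].
  exists (Dspan [:: e]); split=> //; first exact: fgFbar_Dspan (mem_head _ _) e0.
  by apply: Dspan_sub => // y; rewrite inE => /eqP ->.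
have [z zl|F [hF FE Fl]] := IH; first by apply: hl; rewrite inE zl orbT.
have [G [[hG1 [m hG2]] GE Gx]] := star_f_elim (hl x (mem_head _ _)).
have [_ [n hn]] := hF.
pose H := Dspan (m ++ n).
have hH : submodule H by exact: submodule_Dspan.
have GH : G `<=` H.
  by rewrite hG2; apply: Dspan_sub => // y ym; apply: Dspan_mem; rewrite mem_cat ym.
have FH : F `<=` H.
  by rewrite hn; apply: Dspan_sub => // y ym; apply: Dspan_mem; rewrite mem_cat ym orbT.
have fH : Fbar H := Fbar_sub hG1 hH GH.
exists H; split; first by split=> //; exists (m ++ n).
  apply: Dspan_sub => // y; rewrite mem_cat => /orP[] yl.
    by apply: GE; rewrite hG2; apply: Dspan_mem.
  by apply: FE; rewrite hn; apply: Dspan_mem.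
move=> y; rewrite inE => /orP[/eqP ->|/Fl].
  exact: (semistar_mono hstar hG1 fH GH).
exact: (semistar_mono hstar hF.1 fH FH).
Qed.

Lemma star_f_ext E : Fbar E -> E `<=` f E.
Proof.
move=> [hE [e Ee e0]] x Ex.
have hF : fgFbar (Dspan [:: x; e]).
  by apply: fgFbar_Dspan e0; rewrite !inE eqxx orbT.
apply: (star_f_intro hF).
  by apply: Dspan_sub => // y; rewrite !inE => /orP[] /eqP ->.
by apply: (semistar_ext hstar hF.1); apply: Dspan_mem; rewrite mem_head.
Qed.

Lemma submodule_star_f E : Fbar E -> submodule (f E).
Proof.
move=> hE; split.
- by apply: star_f_ext => //; case: hE => [[]].
- move=> x y Ex Ey; have [|F [hF FE Fl]] := @star_f_Dspan E [:: x; y] hE.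
    by move=> z; rewrite !inE => /orP[] /eqP ->.
  apply: (star_f_intro hF) => //; apply: submoduleD; first exact: submodule_star hF.1.
    by apply: Fl; rewrite mem_head.
  by apply: Fl; rewrite !inE eqxx orbT.
- move=> a x /star_f_elim [F [hF FE sF]]; apply: (star_f_intro hF) => //.
  by apply: submoduleM => //; [exact: submodule_star hF.1|exact: baseP].
Qed.

Lemma Fbar_star_f E : Fbar E -> Fbar (f E).
Proof. by move=> hE; apply: (Fbar_sub hE (submodule_star_f hE)); apply: star_f_ext. Qed.

Lemma star_f_idem E : Fbar E -> f (f E) `<=` f E.
Proof.
move=> hE z /star_f_elim [G [[hG [l hl]] GE sG]].
have [x xl|F [hF FE Fl]] := @star_f_Dspan E l hE.
  by apply: GE; rewrite hl; apply: Dspan_mem.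
apply: (star_f_intro hF) => //; apply: star_sub sG => //; first exact: hF.1.
by rewrite hl; apply: Dspan_sub => //; apply: submodule_star hF.1.
Qed.

Lemma star_f_sub E F : Fbar F -> E `<=` f F -> f E `<=` f F.
Proof. by move=> hF EF z /(star_f_mono EF); apply: star_f_idem. Qed.

(** If F witnesses that y is in f J, then x y lies in x F^star = (x F)^star, and x F is a finitely
    generated submodule of f E. Scaling needs x nonzero, so x = 0 is treated apart. *)
Lemma star_f_mul E J x y : Fbar E ->
  (forall j, J j -> f E (x * j)) -> f J y -> f E (x * y).
Proof.
move=> hE h /star_f_elim [F [hF FJ sF]].
have [->|x0] := eqVneq x 0; first by rewrite mul0r; case: (submodule_star_f hE).
apply: star_f_idem => //; apply: (star_f_intro (fgFbar_scale x0 hF)).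
  by move=> _ [z Fz <-]; apply/h/FJ.
by rewrite (semistar_scale hstar x0 hF.1); exists y.
Qed.

(** * Quasi-f-ideals and quasi-f-maximal ideals *)

Lemma star_f_quasi J : Fbar J -> quasi_ideal f (f J `&` B).
Proof.
move=> hJ; have hq := Fbar_capB (Fbar_star_f hJ); split; first by split=> // z [].
rewrite eqEsubset; split=> z [fz Bz]; split=> //; first exact: star_f_ext.
by apply: star_f_sub fz => // u [].
Qed.

Lemma proper_quasi1 (op : set K -> set K) I : proper_quasi_ideal op I -> ~ I 1.
Proof. by move=> [[[[hI _] IB] _] nI] I1; apply: nI; apply: ideal_full. Qed.

(** Zorn's lemma applies because [f] is of finite type: a finitely generated F inside the union of a
    chain already lies in one member. *)
Lemma quasi_max_above I :
  proper_quasi_ideal f I -> exists2 Q, quasi_max f Q & I `<=` Q.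
Proof.
move=> hI; pose S : set (set K) := [set X | X = set0 \/ proper_quasi_ideal f X /\ I `<=` X].
have I0 : I 0 by case: hI => [[[[[]]]]].
have [C CS Ctot|Q [SQ Qmax]] := @Zorn_bigcup _ S.
  have [[X CX IX]|h] := pselect (exists2 X, C X & I `<=` X); last first.
    left; apply/seteqP; split=> // x [Y CY Yx].
    have [Y0|[_ IY]] := CS Y CY; first by rewrite Y0 in Yx.
    by apply: h; exists Y.
  right; set U := \bigcup_(Y in C) Y.
  have IU : I `<=` U by move=> x Ix; exists X => //; apply: IX.
  have CP Y y : C Y -> Y y -> proper_quasi_ideal f Y.
    by move=> /CS [->//|[]].
  have hU : submodule U.
    split; first exact: IU.
      move=> x y [Y CY Yx] [Z CZ Zy].
      have [[[[hY _] _] _] _] := CP Y x CY Yx; have [[[[hZ _] _] _] _] := CP Z y CZ Zy.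
      have [YZ|ZY] := Ctot _ _ CY CZ.
        by exists Z => //; apply: submoduleD => //; apply: YZ.
      by exists Y => //; apply: submoduleD => //; apply: ZY.
    move=> a x [Y CY Yx]; have [[[[hY _] _] _] _] := CP Y x CY Yx.
    by exists Y => //; apply: submoduleM => //; apply: baseP.
  have UB : U `<=` B.
    by move=> x [Y CY Yx]; have [[[_ YB] _] _] := CP Y x CY Yx; apply: YB.
  have fU : Fbar U by apply: (Fbar_sub _ hU IU); case: hI => [[[]]].
  split=> //; split; last first.
    move=> UEB; have : U 1 by rewrite UEB; apply: base1.
    by case=> Y CY Y1; apply: (proper_quasi1 (CP Y 1 CY Y1)).
  split=> //; rewrite eqEsubset; split=> x.
    by move=> Ux; split; [exact: star_f_ext|exact: UB].
  case=> /star_f_elim [F [[hF [l Fl]] FU sF]] Bx.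
  have [Y CY lY] : exists2 Y, C Y & {in l, forall y, Y y} /\ Y 0.
    have : {in l, forall y, U y}.
      by move=> y yl; apply: FU; rewrite Fl; apply: Dspan_mem.
    elim: {F Fl FU hF sF} l => [_|y l IH hl]; first by exists X => //; split=> //; apply: IX.
    have [z zl|Y CY [lY Y0]] := IH; first by apply: hl; rewrite inE zl orbT.
    have [Z CZ Zy] := hl y (mem_head _ _).
    have [YZ|ZY] := Ctot _ _ CY CZ.
      exists Z => //; split; last exact: YZ.
      by move=> w; rewrite inE => /orP[/eqP -> //|/lY /YZ].
    exists Y => //; split=> //.
    by move=> w; rewrite inE => /orP[/eqP ->|/lY //]; apply: ZY.
  have [[[[hY _] YB] YE] _] := CP Y 0 CY lY.2.
  exists Y => //; rewrite YE; split=> //; apply: star_f_intro sF; first by split=> //; exists l.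
  by rewrite Fl; apply: Dspan_sub => //; exact: lY.1.
have nQ : Q <> set0.
  move=> Q0; apply: (Qmax I); last by right; split.
  by rewrite Q0; split=> // /(_ 0); apply.
case: SQ => // -[pQ IQ]; exists Q => //; split=> // J pJ QJ.
apply: contrapT => JQ; apply: (Qmax J); last by right; split=> // x /IQ /QJ.
by split=> // JQ'; apply: JQ; rewrite eqEsubset.
Qed.

(** For x outside Q, maximality puts 1 in f (Q + Dx); since y (Q + Dx) lies in Q, y = y 1 lies in f
    Q. *)
Lemma quasi_max_prime Q : quasi_max f Q -> prime_ideal Q.
Proof.
move=> [pQ mQ]; have Q1 := proper_quasi1 pQ; have [[[fQ QB] QE] nQ] := pQ.
have hQ : submodule Q by case: fQ.
split=> //; first by split=> // BQ; apply: nQ; rewrite eqEsubset.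
move=> x y Bx By Qxy; have [Qx|Qx] := pselect (Q x); [by left|right].
pose J : set K := [set z | exists q b, [/\ Q q, B b & z = q + b * x]].
have QJ : Q `<=` J.
  move=> q Qq; exists q, 0; rewrite mul0r addr0; split=> //; exact: (submodule0 submodule_base).
have hJ : submodule J.
  split; first exact: QJ (submodule0 hQ).
    move=> _ _ [q [b [Qq Bb ->]]] [q' [b' [Qq' Bb' ->]]]; exists (q + q'), (b + b').
    split; [exact: (submoduleD hQ Qq Qq')|exact: (submoduleD submodule_base Bb Bb')|by rewrite mulrDl addrACA].
  move=> a _ [q [b [Qq Bb ->]]]; exists (tofrac a * q), (tofrac a * b).
  split; [by apply: submoduleM => //; apply: baseP|by apply: baseM => //; apply: baseP|].
  by rewrite mulrDr mulrA.
have fJ : Fbar J := Fbar_sub fQ hJ QJ.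
have Jx : J x by exists 0, 1; rewrite add0r mul1r; split=> //; [case: hQ|exact: base1].
have fJ1 : f J 1.
  apply: contrapT => J1; apply: Qx; rewrite -(mQ (f J `&` B)).
  - by split=> //; apply: star_f_ext.
  - by split; [exact: star_f_quasi|move=> e; apply: J1; have := base1; rewrite -e => -[]].
  by move=> q Qq; split; [apply/star_f_ext/QJ|apply: QB].
rewrite QE; split=> //; rewrite -[y]mulr1; apply: star_f_mul fJ1 => //.
move=> _ [q [b [Qq Bb ->]]]; apply: star_f_ext => //; rewrite mulrDr.
apply: submoduleD => //; first exact: submoduleM.
by rewrite mulrCA [y * x]mulrC; apply: submoduleM.
Qed.

(** Otherwise f J /\ D is a proper quasi-f-ideal, so some Q in M(f) contains it and hence J. *)
Lemma star_f_full J : Fbar J -> J `<=` B ->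
  (forall Q, quasi_max f Q -> ~ J `<=` Q) -> f J 1.
Proof.
move=> fJ JB h; apply: contrapT => J1.
have [|Q hQ JQ] := @quasi_max_above (f J `&` B).
  by split; [exact: star_f_quasi|move=> e; apply: J1; have := base1; rewrite -e => -[]].
apply: (h Q hQ) => x Jx; apply: JQ; split; [exact: star_f_ext|exact: JB].
Qed.

Lemma quasi_max_contract Q z : quasi_max f Q -> f Q z -> B z -> Q z.
Proof. by move=> [[[_ QE] _] _] fz Bz; rewrite QE. Qed.

(** * The operation t and the ACC on its quasi-ideals *)

Lemma star_tildeP E z : submodule E ->
  t E z <-> forall Q, quasi_max f Q -> loc Q E z.
Proof.
move=> hE; split=> h Q hQ; have := h Q hQ; rewrite prodm_localization //;
  exact: quasi_max_prime.
Qed.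

Lemma star_tilde_ext E : submodule E -> E `<=` t E.
Proof.
move=> hE x Ex; apply/star_tildeP => // Q hQ.
by apply: loc_ext => //; apply: quasi_max_prime.
Qed.

Lemma submodule_star_tilde E : submodule E -> submodule (t E).
Proof.
move=> hE; have hL Q : quasi_max f Q -> submodule (loc Q E).
  by move=> /quasi_max_prime /submodule_loc; apply.
split.
- by apply: star_tilde_ext => //; case: hE.
- move=> x y /(star_tildeP _ hE) Ex /(star_tildeP _ hE) Ey.
  apply/(star_tildeP _ hE) => Q hQ; exact: (submoduleD (hL Q hQ) (Ex Q hQ) (Ey Q hQ)).
- move=> a x /(star_tildeP _ hE) Ex.
  apply/(star_tildeP _ hE) => Q hQ; exact: (submoduleM (hL Q hQ) (baseP a) (Ex Q hQ)).
Qed.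

(** The ideal J = (E : x) /\ D lies in no Q of M(f), so 1 is in f J and x = x 1 is in f E. *)
Lemma star_tilde_le E : Fbar E -> t E `<=` f E.
Proof.
move=> [hE [e Ee e0]] x /(star_tildeP _ hE) tx.
have fE : Fbar E by split=> //; exists e.
pose J := [set z | E (z * x)] `&` B.
have J1 : f J 1.
  apply: star_f_full => [|z []//|Q hQ JQ].
    split; first by apply: submoduleI; [exact: submodule_preim|exact: submodule_base].
    (* J is nonzero: for a denominator b of x / e, b x is a D-multiple of e. *)
    have [b [Bb b0 Bbx]] := base_den (x / e).
    have [Ebx|] := pselect (E (b * x)); first by exists b.
    by case; rewrite -[x](mulfVK e0) mulrA; apply: submoduleM.
  have [s [Bs Qs Esx]] := tx Q hQ.
  by apply: Qs; apply: JQ.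
rewrite -[x]mulr1; apply: star_f_mul J1 => // j [Ejx _].
by apply: star_f_ext => //; rewrite mulrC.
Qed.

(** The hypothesis on [loc] makes E a D_Q-module; contractions of such modules supply the
    quasi-t-ideals for the ACC. *)
Lemma loc_quasi Q E : quasi_max f Q -> Fbar E -> loc Q E `<=` E ->
  quasi_ideal t (E `&` B).
Proof.
move=> hQ hE QE; have hC := Fbar_capB hE; split; first by split=> // x [].
rewrite eqEsubset; split=> x [Ex Bx]; split=> //; first by apply: star_tilde_ext => //; case: hC.
move/(star_tildeP _ hC.1): Ex => /(_ Q hQ) Ex; apply: QE.
by move: Ex; apply: loc_mono => y [].
Qed.

Lemma quasi_max_quasi_prime Q : quasi_max f Q -> quasi_prime t Q.
Proof.
move=> hQ; have pQ := quasi_max_prime hQ; split=> //.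
have [[[[fQ QB] QE] nQ] _] := hQ; split=> //.
rewrite eqEsubset; split=> x.
  by move=> Qx; split; [apply: star_tilde_ext => //; case: fQ|exact: QB].
by case=> tx Bx; rewrite QE; split=> //; apply: star_tilde_le.
Qed.

Lemma star_f_le E : Fbar E -> f E `<=` star E.
Proof.
by move=> hE z /star_f_elim [F [[hF _] FE]]; apply: (semistar_mono hstar).
Qed.

(** The ACC concerns ideals of D, so it is the contractions to D that become stationary; elements
    must be moved into D before this is applied. *)
Lemma acc_loc Q (E : nat -> set K) :
  star_noetherian t -> quasi_max f Q -> (forall n, Fbar (E n)) ->
  (forall n, E n `<=` E n.+1) ->
  exists N, loc Q (E N.+1) `&` B `<=` loc Q (E N).
Proof.
move=> acc hQ hE EE; have pQ := quasi_max_prime hQ.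
have [n|n|N hN] := acc (fun n => loc Q (E n) `&` B).
- apply: (loc_quasi hQ); last exact: loc_idem.
  apply: (Fbar_sub (hE n)); last exact: loc_ext.
  exact: (submodule_loc pQ (hE n).1).
- by move=> x [Lx Bx]; split=> //; move: Lx; apply: loc_mono.
by exists N; rewrite (hN _ (leqnSn N)) => x [].
Qed.

(** If all w_n = y / x^n were in D_Q, the modules D w_n would ascend since w_n = x w_(n+1), and
    stationarity would make x a unit of D_Q. *)
Lemma loc_archimedean Q x y : star_noetherian t -> quasi_max f Q ->
  Q x -> x != 0 -> y != 0 -> exists n, ~ loc Q B (y / x ^+ n).
Proof.
move=> acc hQ Qx x0 y0; apply: contrapT => hn.
have {}hn n : loc Q B (y / x ^+ n) by apply: contrapT => h; apply: hn; exists n.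
have pQ := quasi_max_prime hQ; have Bx := prime_base pQ Qx.
pose w n := y / x ^+ n.
have w0 n : w n != 0 by rewrite mulf_neq0 ?invr_neq0 ?expf_neq0.
have wS n : w n = x * w n.+1 by rewrite /w exprS invfM mulrCA mulVKf.
have hw n : loc Q B (w n) := hn n.
clearbody w.
have [n|n|N hN] := @acc_loc Q (fun n => Dspan [:: w n]) acc hQ.
- exact: (fgFbar_Dspan (mem_head _ _) (w0 n)).1.
- apply: Dspan_sub; first exact: submodule_Dspan.
  move=> z; rewrite inE => /eqP ->; rewrite (wS n); apply: submoduleM => //.
    exact: submodule_Dspan.
  by apply: Dspan_mem; rewrite mem_head.
have [s [Bs Qs Bsw]] := hw N.+1.
have [|s' [Bs' Qs' h]] := hN (s * w N.+1).
  split=> //; apply: loc_ext => //; apply: submoduleM => //; first exact: submodule_Dspan.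
  by apply: Dspan_mem; rewrite mem_head.
have {h} : B (s' * (s * w N.+1) / w N).
  apply: (Dspan_sub (submodule_preim (w N)^-1 submodule_base)) h => z.
  by rewrite inE /= => /eqP ->; rewrite divff //; apply: base1.
rewrite (wS N) => h.
have [_] := prime_notinM pQ Bs' Qs' Bs Qs; apply.
have -> : s' * s = s' * (s * w N.+1) / (x * w N.+1) * x.
  by rewrite [x * _]mulrC invfM !mulrA mulfVK // mulfK.
exact: (submoduleM (prime_submodule pQ) h Qx).
Qed.

(** * star-Dedekind domains *)

Section OneToTwo.
Hypotheses (acc : star_noetherian star) (hPMD : PstarMD star).

(** A maximal F^star /\ D, with F finitely generated inside I, absorbs every a in I, as F + Da
    shows. Hence I^star <= F^star <= I^f. *)
Lemma quasi_ideal_star_f I : quasi_ideal f I -> quasi_ideal star I.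
Proof.
move=> [[fI IB] IE]; split; first by split.
have [hI [e Ie e0]] := fI.
pose S := [set X | exists F, [/\ fgFbar F, F `<=` I & X = star F `&` B]].
have qF F : Fbar F -> quasi_ideal star (star F `&` B).
  move=> hF; have hsF := semistar_Fbar hstar hF; have hq := Fbar_capB hsF.
  split; first by split=> // x [].
  rewrite eqEsubset; split=> x [sx Bx]; split=> //.
    by apply: (semistar_ext hstar hq).
  by apply: star_sub sx => // z [].
have [||_ [F [hF FI ->]] maxF] := @acc_max star S (star (Dspan [:: e]) `&` B) acc.
- by move=> _ [F [[hF _] _ ->]]; apply: qF.
- exists (Dspan [:: e]); split=> //; first exact: fgFbar_Dspan (mem_head _ _) e0.
  by apply: Dspan_sub => // z; rewrite inE => /eqP ->.
have IF : I `<=` star F.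
  move=> a Ia; have [G [hG FG Ga GI]] := fgFbar_cons a hF.
  have SG : S (star G `&` B) by exists G; split=> //; apply: GI.
  suff : (star F `&` B) a by case.
  rewrite -(maxF _ SG) => [|z [sz Bz]].
    by split; [exact: (semistar_ext hstar hG.1)|exact: IB].
  by split=> //; apply: (semistar_mono hstar hF.1 hG.1 FG).
rewrite eqEsubset; split=> x.
  by move=> Ix; split; [exact: (semistar_ext hstar fI)|exact: IB].
case=> sx Bx; rewrite IE; split=> //; apply: (star_f_intro hF FI).
exact: (star_sub fI hF.1 IF sx).
Qed.

(* The P*MD condition, localized at [Q]: the fractional ideal [G] becomes principal. *)
Lemma PstarMD_loc Q F G : quasi_max f Q -> Fbar F -> fgFbar G ->
  F `<=` G -> G `<=` f F ->
  exists u v, [/\ F u, forall g, G g -> B (g * v) & ~ Q (u * v)].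
Proof.
move=> hQ hF hG FG GF; apply: contrapT => h.
have [[[[fQ _] _] _] _] := hQ.
have pQ := quasi_max_prime hQ.
have {}h u v : F u -> (forall g, G g -> B (g * v)) -> Q (u * v).
  by move=> Fu Gv; apply: contrapT => Quv; apply: h; exists u, v.
have [_ [l Gl]] := hG.
(* [d] turns G into an ideal of D, so that [hPMD] applies. *)
have [d [Bd d0 dl]] := base_den_seq l.
have hdG := fgFbar_scale d0 hG.
have dGB : scale d G `<=` B.
  rewrite Gl scale_Dspan; apply: Dspan_sub; first exact: submodule_base.
  by move=> _ /mapP[x xl ->]; apply: dl.
have inv : star_invertible f (scale d G).
  by apply: hPMD; [split=> //; exact: hdG.1|exact: hdG.2].
have : f (prodm (scale d G) (colon B (scale d G))) 1.
  rewrite inv; apply: star_f_ext; [exact: Fbar_base|exact: base1].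
move=> f1; apply: (prime1 pQ); apply: (quasi_max_contract hQ) base1.
(* It suffices that dG (D : dG) lies in f Q: for y in (D : dG), y d is in (D : G), hence sends F
   into Q by [h], and G <= f F into f Q. *)
apply: (star_f_sub fQ _ f1).
apply: prodm_sub; first exact: submodule_star_f.
move=> _ y [g Gg <-] /colonP cy; rewrite mulrC mulrA.
apply: star_f_mul (GF g Gg) => // j Fj.
apply: star_f_ext => //.
rewrite [_ * j]mulrC; apply: h => // g' Gg'.
by rewrite [g' * _]mulrC -mulrA; apply: cy; exists g'.
Qed.

(** For x in F^star and G = F + Dx, [PstarMD_loc] gives u in F and v with u v outside Q; then (u v)
    x = (x v) u lies in E. *)
Lemma star_tilde_eq E : Fbar E -> t E = f E.
Proof.
move=> hE; rewrite eqEsubset; split; first exact: star_tilde_le.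
move=> x /star_f_elim [F [hF FE sFx]]; apply/(star_tildeP _ hE.1) => Q hQ.
have [G [hG FG Gx GE]] := fgFbar_cons x hF.
have [|u [v [Fu Gv Quv]]] := PstarMD_loc hQ hF.1 hG FG.
  rewrite star_f_fg //; apply: GE => //; first exact: submodule_star hF.1.
  exact: (semistar_ext hstar hF.1).
exists (u * v); split=> //; first exact/Gv/FG.
rewrite mulrC mulrA mulrAC; apply: (submoduleM hE.1); first exact: Gv.
exact: FE.
Qed.

Lemma star_tilde_noetherian : star_noetherian t.
Proof.
move=> I hI; apply: acc => n; apply: quasi_ideal_star_f.
by have [[fI IB] IE] := hI n; split; [split|rewrite -star_tilde_eq].
Qed.

Lemma prime_below_quasi_max P Q : quasi_max f Q -> prime_ideal P -> Fbar P ->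
  P `<=` Q -> P = Q.
Proof.
move=> hQ pP [hP [y Py y0]] PQ; rewrite eqEsubset; split=> // x Qx.
apply: contrapT => Px; have pQ := quasi_max_prime hQ.
have x0 := notin_neq0 pP Px; have Bx := prime_base pQ Qx.
have [n []] := loc_archimedean star_tilde_noetherian hQ Qx x0 y0.
apply: (loc_mono (prime_base pP)).
elim: n => [|n IH]; first by rewrite divr1; apply: loc_ext.
have -> : y / x ^+ n.+1 = y / x ^+ n / x by rewrite exprSr invfM mulrA.
move: (y / _) IH => z [s [Bs Qs Psz]].
(* The module (x, s z) becomes principal at Q. As (s z v) x = (x v) (s z) is in P and x is not, s z
   v is in P, hence in Q; so x v is outside Q, and z / x = s z v / (x v s) is in P D_Q. *)
have hG : fgFbar (Dspan [:: x; s * z]) by exact: fgFbar_Dspan (mem_head _ _) x0.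
have [//||u [v [Gu Gv Quv]]] := PstarMD_loc hQ hG.1 hG.
  exact: star_f_ext hG.1.
have Bxv : B (x * v) by apply/Gv/Dspan_mem/mem_head.
have Bszv : B (s * z * v) by apply/Gv/Dspan_mem; rewrite !inE eqxx orbT.
have Pszv : P (s * z * v).
  have [_ _ /(_ _ _ Bszv Bx)[]] := pP => //.
  rewrite -mulrA mulrC [v * x]mulrC.
  exact: (submoduleM hP Bxv Psz).
have Qxv : ~ Q (x * v).
  move=> Qxv; apply: Quv.
  apply: (Dspan_sub (submodule_preim v (prime_submodule pQ))) Gu => w.
  by rewrite !inE => /orP[] /eqP -> //=; apply: PQ.
exists (x * v * s); have [? ?] := prime_notinM pQ Bxv Qxv Bs Qs; split=> //.
suff -> : x * v * s * (z / x) = s * z * v by [].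
by rewrite -[x * v * s]mulrA [LHS]mulrC [LHS]mulrA mulfVK // [v * s]mulrC mulrA [z * s]mulrC.
Qed.

(** If z F^t <= F^t and F D_Q = u D_Q, then z u is in u D_Q, so z is in D_Q. Conversely F = D serves
    for every z in D^t. *)
Lemma star_tilde_quasi_integrally_closed : quasi_integrally_closed t.
Proof.
have hB := submodule_base.
have fgB : fgFbar B.
  split; first exact: Fbar_base; exists [:: 1]; rewrite eqEsubset; split=> [x Bx|].
    rewrite -[x]mulr1; apply: submoduleM => //; first exact: submodule_Dspan.
    by apply: Dspan_mem; rewrite mem_head.
  by apply: Dspan_sub => // x; rewrite inE => /eqP ->; apply: base1.
rewrite /quasi_integrally_closed eqEsubset; split=> z.
  move=> /(star_tildeP _ hB) tz; exists B => //; apply/colonP => x /(star_tildeP _ hB) tx.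
  apply/(star_tildeP _ hB) => Q hQ; rewrite mulrC; apply: loc_mulr => //; last exact: tz.
    exact: quasi_max_prime.
  exact: tx.
case=> F hF /colonP zF; apply/(star_tildeP _ hB) => Q hQ.
have [//||u [v [Fu Gv Quv]]] := PstarMD_loc hQ hF.1 hF; first exact: star_f_ext hF.1.
have := zF u (star_tilde_ext hF.1.1 Fu).
move=> /(star_tildeP _ hF.1.1) /(_ Q hQ) [s [Bs Qs /Gv Bv]].
have pQ := quasi_max_prime hQ.
have [? ?] := prime_notinM pQ Bs Qs (Gv u Fu) Quv.
exists (s * (u * v)); split=> //; move: Bv; rewrite [z * u]mulrC -!mulrA.
by rewrite [z * v]mulrC.
Qed.

(** For x outside D^star with denominator b, f (bD) /\ D is proper: 1 in f (bD) and x b D <= D would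
    put x in f D <= D^star. *)
Lemma quasi_max_ex : star B <> [set: K] -> exists Q, quasi_max f Q.
Proof.
move=> hK; have [x sx] : exists x, ~ star B x.
  apply: contrapT => h; apply: hK; rewrite eqEsubset; split=> // x _.
  by apply: contrapT => sx; apply: h; exists x.
have [b [Bb b0 Bbx]] := base_den x.
have fb : Fbar (Dspan [:: b]) := (fgFbar_Dspan (mem_head _ _) b0).1.
have [|Q hQ _] := @quasi_max_above (f (Dspan [:: b]) `&` B); last by exists Q.
split; first exact: star_f_quasi.
move=> e; apply: sx; apply: (star_f_le Fbar_base); rewrite -[x]mulr1.
have [f1 _] : (f (Dspan [:: b]) `&` B) 1 by rewrite e; apply: base1.
apply: star_f_mul f1; first exact: Fbar_base.
move=> j hj; apply: star_f_ext; first exact: Fbar_base.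
rewrite mulrC; apply: (Dspan_sub (submodule_preim x submodule_base)) hj => w.
by rewrite inE => /eqP ->.
Qed.

End OneToTwo.

(** * Integral closure *)

Lemma star_tilde_mul E x y : submodule E -> t E x -> t B y -> t E (x * y).
Proof.
move=> hE /(star_tildeP _ hE) Ex /(star_tildeP _ submodule_base) By.
apply/(star_tildeP _ hE) => Q hQ.
exact: (loc_mulr (quasi_max_prime hQ) hE (Ex Q hQ) (By Q hQ)).
Qed.

Lemma star_tilde_idem E : submodule E -> t (t E) `<=` t E.
Proof.
move=> hE x /(star_tildeP _ (submodule_star_tilde hE)) tx.
apply/(star_tildeP _ hE) => Q hQ; apply: loc_idem; first exact: quasi_max_prime.
by have [s [Bs Qs /(star_tildeP _ hE) /(_ Q hQ)]] := tx Q hQ; exists s.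
Qed.

Lemma integrally_closed_star_tilde :
  quasi_integrally_closed t -> integrally_closed (t B).
Proof.
move=> hqic z _ [p [p_monic tp pz]]; rewrite hqic.
pose n := (size p).-1.
have sp : size p = n.+1 by rewrite prednK // size_poly_gt0 monic_neq0.
pose F : set K := Dspan [seq z ^+ i | i <- iota 0 n].
have hF : submodule F := submodule_Dspan _.
have Fz i : (i < n)%N -> F (z ^+ i).
  by move=> i_n; apply: Dspan_mem; apply/mapP; exists i; rewrite ?mem_iota.
(* A nonzero constant has no root; so 1 is among the generators, and F is nonzero. *)
have n_gt0 : (0 < n)%N.
  rewrite lt0n; apply/eqP => n0; move: pz.
  have /size_poly1P[c c0 pc] : size p == 1%N by rewrite sp n0.
  by rewrite pc rootC (negPf c0).
have fF : fgFbar F.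
  apply: (@fgFbar_Dspan _ 1); last exact: oner_neq0.
  by apply/mapP; exists 0%N; rewrite ?mem_iota ?expr0.
have pz0 : z ^+ n = - \sum_(i < n) z ^+ i * p`_i.
  move/rootP: pz; rewrite horner_coef sp big_ord_recr /=.
  have -> : p`_n = 1 by move/monicP: p_monic; rewrite /lead_coef.
  rewrite mul1r addrC => /eqP; rewrite addr_eq0 => /eqP ->; congr (- _).
  by apply: eq_bigr => i _; rewrite mulrC.
have tF := submodule_star_tilde hF.
have Fz_sub : F `<=` [set y | t F (y * z)].
  apply: Dspan_sub; first exact: submodule_preim.
  move=> _ /mapP[i + ->] /=; rewrite mem_iota add0n /= -exprSr => i_n.
  (* Only z z^(n-1) leaves the list of generators; the monic equation rewrites it with coefficients
     in D^t, which is why the target is t F and not F. *)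
  have [Si_n|] := ltnP i.+1 n; first exact: star_tilde_ext hF _ (Fz _ Si_n).
  rewrite leq_eqVlt ltnNge i_n orbF => /eqP <-; rewrite pz0.
  apply: (submoduleN tF); apply: (submodule_sum tF) => j.
  by apply: star_tilde_mul => //; apply: star_tilde_ext => //; apply: Fz.
exists F => //; apply/colonP => x /(star_tildeP _ hF) tx.
apply: star_tilde_idem => //; apply/(star_tildeP _ tF) => Q hQ.
have [s [Bs Qs /Fz_sub h]] := tx Q hQ; exists s; split=> //.
by rewrite [z * x]mulrC mulrA.
Qed.

(** * Local uniformizers and the P*MD property *)

Section ThreeToOne.
Hypotheses (acc : star_noetherian t) (hic : integrally_closed (t B)).
Hypothesis dim1 : forall P Q, quasi_prime t P -> quasi_prime t Q -> P `<=` Q -> P = Q.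

(** Since t <= f <= star, quasi-star-ideals are quasi-t-ideals. *)
Lemma star_noetherian_of_tilde : star_noetherian star.
Proof.
move=> I hI; apply: acc => n; have [[fI IB] IE] := hI n; split=> //.
rewrite eqEsubset; split=> x.
  by move=> Ix; split; [apply: star_tilde_ext => //; case: fI|exact: IB].
by case=> tx Bx; rewrite IE; split=> //; apply: star_f_le => //; apply: star_tilde_le.
Qed.

(** Multiplied by s^n, the equation becomes monic of degree n + 1 in s w; so s w lies in D^t <= D_Q,
    where s is a unit. *)
Lemma loc_integral Q w n (p : {poly K}) s : quasi_max f Q -> B s -> ~ Q s ->
  (forall i, B p`_i) -> (size p <= n.+1)%N -> s * w ^+ n.+1 = p.[w] -> loc Q B w.
Proof.
move=> hQ Bs Qs Bp sp hw; have pQ := quasi_max_prime hQ.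
have hB := submodule_base.
(* Chosen so that q(s w) = s^n p(w). *)
pose q := \poly_(i < n.+1) (p`_i * s ^+ (n - i)).
have Bq i : B q`_i.
  rewrite coef_poly; case: ifP => _; last by case: hB.
  by apply: baseM => //; apply: baseX.
have tw : t B (s * w).
  apply: hic.
    have [b [Bb b0 Bbw]] := base_den (s * w).
    exists (b * (s * w)), b; split=> //; try exact: star_tilde_ext.
    by rewrite [b * _]mulrC mulfK.
  exists ('X^(n.+1) - q); split.
  - by rewrite monicE lead_coefDl ?lead_coefXn // size_polyN size_polyXn ltnS size_poly.
  - move=> i; apply: star_tilde_ext => //; rewrite coefB coefXn.
    apply: submoduleD => //; last exact: submoduleN.
    by case: eqP => _; [exact: base1|case: hB].
  apply/rootP; rewrite hornerD hornerN hornerXn horner_poly exprMn exprSr -mulrA hw.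
  rewrite (horner_coef_wide _ sp) mulr_sumr; apply/eqP; rewrite subr_eq0; apply/eqP.
  apply: eq_bigr => i _; rewrite exprMn.
  rewrite mulrCA -[RHS]mulrA; congr (_ * _); rewrite mulrA -exprD subnK //.
  by rewrite -ltnS.
move/(star_tildeP _ hB): tw => /(_ Q hQ) [s' [Bs' Qs' h]].
by have [? ?] := prime_notinM pQ Bs' Qs' Bs Qs; exists (s' * s); rewrite -mulrA.
Qed.

(** The classical fact that a one-dimensional integrally closed Noetherian local domain has a
    principal maximal ideal, for D_Q. *)
Lemma loc_uniformizer Q : quasi_max f Q ->
  exists q, [/\ Q q, q != 0 & forall x, Q x -> loc Q B (x / q)].
Proof.
move=> hQ; have pQ := quasi_max_prime hQ; have hs := prime_submodule pQ.
have hB := submodule_base.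
have [[[[[_ [a Qa a0]] _] _] _] _] := hQ.
have Ba := prime_base pQ Qa.
pose A := [set z | loc Q B (z * a^-1)].
have hA : submodule A := submodule_preim _ (submodule_loc pQ hB).
have locA : loc Q A `<=` A.
  move=> z [s [Bs Qs]]; rewrite /A /= -mulrA => h; apply: loc_idem => //.
  by exists s.
pose E b := [set z | A (z * b)].
pose S := [set M | exists b, [/\ B b, ~ A b & M = E b `&` B]].
have qE b : B b -> quasi_ideal t (E b `&` B).
  move=> Bb; apply: (loc_quasi hQ).
    split; first exact: submodule_preim.
    by exists a => //; rewrite /E /A /= mulrAC divff // mul1r; apply: loc_ext.
  by move=> z [s [Bs Qs]]; rewrite /E /= -mulrA => h; apply: locA; exists s.
have A1 : ~ A 1.
  rewrite /A /= mul1r => -[s [Bs Qs Bsa]]; apply: Qs.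
  by rewrite -[s](mulfVK a0); apply: submoduleM.
have [||_ [b [Bb Ab ->]] maxE] := @acc_max t S (E 1 `&` B) acc.
- by move=> _ [b [Bb _ ->]]; apply: qE.
- by exists 1; split=> //; apply: base1.
have [[fEb _] _] := qE b Bb.
have EQ : E b `&` B = Q.
  apply: dim1; [split; last exact: qE|exact: quasi_max_quasi_prime|].
    split; [by case: fEb|split=> [x []//|BE]|].
      by apply: Ab; have [] := BE 1 base1; rewrite /E /= mul1r.
    (* If y b is not in A, then (A : y b) /\ D belongs to [S] and contains (A : b) /\ D, so
       maximality puts x in (A : b). *)
    move=> x y Bx By [Exy _].
    have [Ey|Ey] := pselect (E b y); [by right|left].
    rewrite -(maxE (E (y * b) `&` B)).
    - by split=> //; rewrite /E /= mulrA.
    - by exists (y * b); split=> //; apply: baseM.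
    move=> z [Ez Bz]; split=> //; rewrite /E /= mulrCA.
    exact: (submoduleM hA By Ez).
  move=> z [Ez Bz]; apply: contrapT => Qz; apply: Ab; apply: locA.
  by exists z.
pose w := b / a.
have Qw x : Q x -> loc Q B (x * w).
  move=> Qx; have [Ex _] : (E b `&` B) x by rewrite EQ.
  by rewrite /w mulrA.
have nw : ~ loc Q B w by [].
clearbody w.
have [q Qq nq] : exists2 q, Q q & ~ loc Q Q (q * w).
  apply: contrapT => h.
  have {}h q : Q q -> loc Q Q (q * w).
    by move=> Qq; apply: contrapT => nq; apply: h; exists q.
  have aw i : loc Q Q (a * w ^+ i).
    elim: i => [|i [s [Bs Qs Qsa]]]; first by rewrite mulr1; apply: loc_ext.
    apply: loc_idem => //; exists s; split=> //.
    by rewrite exprSr !mulrA -[s * a * _]mulrA; apply: h.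
  pose L n := Dspan [seq a * w ^+ i | i <- iota 0 n.+1].
  have hL n : submodule (L n) := submodule_Dspan _.
  have Lw n i : (i <= n)%N -> L n (a * w ^+ i).
    by move=> i_n; apply: Dspan_mem; apply/mapP; exists i; rewrite ?mem_iota ?ltnS.
  have [n|n|N hN] := acc_loc (E := L) acc hQ.
  - split=> //; exists a => //.
    by have := Lw n 0%N isT; rewrite mulr1.
  - apply: Dspan_sub => // _ /mapP[i + ->]; rewrite mem_iota add0n /= ltnS => i_n.
    by apply/Lw/leqW.
  have [s [Bs Qs Qsa]] := aw N.+1.
  have [|s' [Bs' Qs' h']] := hN (s * (a * w ^+ N.+1)).
    split; last exact: (prime_base pQ).
    by apply: loc_ext => //; apply: (submoduleM (hL N.+1) Bs); apply: Lw.
  (* Stationarity expresses a w^(N+1), up to the units s and s' of D_Q, as a p(w) with p of degree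
     at most N; cancelling a gives the equation for [loc_integral]. *)
  have [p [Bp sp hp]] : exists p : {poly K}, [/\ forall i, B p`_i, (size p <= N.+1)%N
      & s' * (s * (a * w ^+ N.+1)) = a * p.[w]].
    move: h'; apply: (@Dspan_sub [set z | exists p : {poly K},
      [/\ forall i, B p`_i, (size p <= N.+1)%N & z = a * p.[w]]]).
      split.
      - exists 0; rewrite size_poly0 horner0 mulr0; split=> // i.
        by rewrite coef0; case: hB.
      - move=> _ _ [p [Bp sp ->]] [r [Br sr ->]]; exists (p + r).
        rewrite hornerD mulrDr; split=> //.
          by move=> i; rewrite coefD; apply: submoduleD.
        by rewrite (leq_trans (size_polyD _ _)) // geq_max sp.
      - move=> c _ [p [Bp sp ->]]; exists (tofrac c *: p).
        rewrite hornerZ mulrCA; split=> //.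
          by move=> i; rewrite coefZ; apply: submoduleM => //; apply: baseP.
        exact: leq_trans (size_scale_leq _ _) sp.
    move=> _ /mapP[i + ->]; rewrite mem_iota add0n /= ltnS => i_N.
    exists 'X^i; rewrite hornerXn size_polyXn ltnS; split=> // j.
    by rewrite coefXn; case: eqP => _; [exact: base1|case: hB].
  have [Bss Qss] := prime_notinM pQ Bs' Qs' Bs Qs.
  apply: nw; apply: (loc_integral hQ Bss Qss Bp sp).
  apply: (mulfI a0); rewrite -hp.
  by rewrite [LHS]mulrCA -[LHS]mulrA.
have q0 : q != 0.
  by apply: contra_not_neq nq => ->; rewrite mul0r; case: (submodule_loc pQ hs).
exists q; split=> // x Qx.
(* e q w lies in D outside Q, so q w is a unit of D_Q, and x / q = x w / (q w). *)
have [e [Be Qe Beq]] := Qw q Qq.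
have Qeq : ~ Q (e * (q * w)) by move=> h; apply: nq; exists e.
have [s [Bs Qs Bsx]] := Qw x Qx.
have [? ?] := prime_notinM pQ Bs Qs Beq Qeq.
exists (s * (e * (q * w))); split=> //.
suff -> : s * (e * (q * w)) * (x / q) = e * (s * (x * w)) by apply: baseM.
rewrite -!mulrA [LHS]mulrCA; congr (_ * _); congr (_ * _).
by rewrite [LHS]mulrC [w * _]mulrA mulfVK // mulrC.
Qed.

Lemma PstarMD_of_tilde : PstarMD star.
Proof.
move=> I [[hI [x Ix x0]] IB] [l Il]; have hB := submodule_base.
have fI : Fbar I by split=> //; exists x.
pose J := prodm I (colon B I).
have hJ : submodule J := submodule_prodm _ hI.
have JB : J `<=` B.
  by apply: prodm_sub => // u v Iu /colonP Bv; rewrite mulrC; apply: Bv.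
have fJ : Fbar J.
  apply: (Fbar_sub fI hJ) => y Iy; rewrite -[y]mulr1; apply: prodm_mul => //.
  by apply/colonP => z Iz; rewrite mul1r; apply: IB.
suff f1 : f J 1.
  rewrite /star_invertible -/J eqEsubset; split; first exact: star_f_mono.
  move=> y; apply: star_f_sub => // z Bz; rewrite -[z]mulr1.
  by apply: (submoduleM (submodule_star_f fJ)).
apply: star_f_full => // Q hQ JQ; have pQ := quasi_max_prime hQ.
have [q [Qq q0 Qdiv]] := loc_uniformizer hQ.
(* The largest exponent exists by [loc_archimedean], applied to the nonzero x in I. *)
have [n Iq nIq] : exists2 n, (forall y, I y -> loc Q B (y / q ^+ n)) &
    ~ (forall y, I y -> loc Q B (y / q ^+ n.+1)).
  apply: contrapT => h; have [n] := loc_archimedean acc hQ Qq q0 x0.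
  suff /(_ n x Ix) : forall n y, I y -> loc Q B (y / q ^+ n) by [].
  elim=> [y Iy|m IH]; first by rewrite divr1; apply: loc_ext => //; apply: IB.
  by apply: contrapT => h'; apply: h; exists m.
have [|s [Bs Qs sl]] := @loc_den_seq Q pQ B [seq y / q ^+ n | y <- l] hB.
  by move=> _ /mapP[y yl ->]; apply: Iq; rewrite Il; apply: Dspan_mem.
(* So v = s / q^n is in (D : I); with I v inside Q, division by q would give I <= q^(n+1) D_Q. *)
have Bv y : I y -> B (y * (s / q ^+ n)).
  rewrite Il; apply: (Dspan_sub (submodule_preim (s / q ^+ n) hB)) => z zl /=.
  by rewrite mulrCA; apply: sl; apply/mapP; exists z.
apply: nIq => u Iu; have : Q (u * (s / q ^+ n)).
  by apply: JQ; apply: prodm_mul => //; apply/colonP => y Iy; rewrite mulrC; apply: Bv.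
move/Qdiv => h; apply: loc_idem => //; exists s; split=> //.
by have -> : s * (u / q ^+ n.+1) = u * (s / q ^+ n) / q by rewrite exprSr invfM mulrCA !mulrA.
Qed.

End ThreeToOne.

(** * Dimension *)

(** The supremum is the greatest element if [A] is bounded and +oo otherwise. Its existence matters
    because [supremum] falls back to a default value without it. *)
Lemma supremums_nat (A : set nat) n : A n ->
  supremums [set (m%:Z)%:E | m in A] !=set0.
Proof.
move=> An; have [[m Am mub]|nomax] := pselect (exists2 m, A m & forall k, A k -> (k <= m)%N).
  exists (m%:Z)%:E; split=> [_ [k Ak <-]|u ub]; last by apply: ub; exists m.
  by rewrite lee_fin lez_nat; apply: mub.
have big k : exists2 m, A m & (k <= m)%N.
  elim: k => [|k [m Am km]]; first by exists n.
  apply: contrapT => h; apply: nomax; exists m => // j Aj.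
  by rewrite leqNgt; apply/negP => mj; apply: h; exists j => //; apply: leq_trans mj.
exists +oo%E; split=> [_ [k _ <-]|u ub]; first by rewrite leey.
case: u ub => [r||] ub //.
  have [m Am rm] := big `|r|%N.+1.
  have /ub : [set (m%:Z)%:E | m in A] (m%:Z)%:E by exists m.
  rewrite lee_fin => /le_trans/(_ (ler_norm r)).
  by rewrite -abszE lez_nat leqNgt rm.
by have /ub : [set (m%:Z)%:E | m in A] (n%:Z)%:E by exists n.
Qed.

Section Dimension.
Variable op : set K -> set K.

Lemma quasi_prime_neq0 P : quasi_prime op P -> P <> [set 0].
Proof. by move=> [_ [[[_ [x Px x0]] _] _]] P0; move: Px x0; rewrite P0 => ->; rewrite eqxx. Qed.

Lemma quasi_prime_gt0 P : quasi_prime op P -> [set 0] `<` P.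
Proof.
move=> hP; have [_ [[[[P0 _ _] _] _] _]] := hP.
split=> [_ -> //|P00]; apply: (quasi_prime_neq0 hP).
by rewrite eqEsubset; split=> // _ ->.
Qed.

(** A chain of length 0 would give P = 0, and a longer one than 1 two distinct comparable
    quasi-primes, so every height is 1; [Q] makes the set of heights nonempty. *)
Lemma star_dim1 Q : quasi_prime op Q ->
  (forall P P', quasi_prime op P -> quasi_prime op P' -> P `<=` P' -> P = P') ->
  star_dim op = 1%E.
Proof.
move=> hQ incomp.
have h1 P : quasi_prime op P -> star_height op P = 1%E.
  move=> hP; rewrite /star_height.
  suff -> : [set n | chain_to op P n] = [set 1%N] by rewrite image_set1 supremum1.
  rewrite eqEsubset; split=> [n [C [C0 Cn Cq Clt]]|_ ->].
    case: n Cn Cq Clt => [|[//|n]] Cn Cq Clt.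
      by case: (quasi_prime_neq0 hP); rewrite -Cn -C0.
    have [C12 C21] := Clt 1%N isT; case: C21.
    by rewrite (incomp _ _ (Cq 1%N isT) (Cq 2%N isT)).
  exists (fun i => if i == 0%N then [set 0] else P); split=> //.
    by case=> [|[|i]].
  by case=> // _; apply: quasi_prime_gt0.
rewrite /star_dim; suff -> : [set star_height op P | P in [set P | quasi_prime op P]] = [set 1%E].
  by rewrite supremum1.
rewrite eqEsubset; split=> [_ [P hP <-]|_ ->]; first exact: h1.
by exists Q => //; apply: h1.
Qed.

Lemma star_dim1_incomparable P Q : star_dim op = 1%E ->
  quasi_prime op P -> quasi_prime op Q -> P `<=` Q -> P = Q.
Proof.
move=> dim1 hP hQ PQ; rewrite eqEsubset; split=> //; apply: contrapT => QP.
have ch2 : chain_to op Q 2.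
  exists (fun i => if i is i'.+1 then (if i' == 0%N then P else Q) else [set 0]).
  split=> // [|[|[|i]]] //; first by case=> [|[|[|i]]].
  by move=> _; apply: quasi_prime_gt0.
have h2 : (2%:Z%:E <= star_height op Q)%E.
  by apply: ge_supremum_Nmem; [exact: supremums_nat ch2|exists 2%N].
(* Both fallback values are 0, so the value 1 is a genuine upper bound, against the height at least
   2 of Q. *)
move: dim1; rewrite /star_dim /supremum; case: ifP => [_ /eqP//|_].
case: xgetP => [y -> [yub _] y1|_ /eqP//].
have /yub : [set star_height op P | P in [set P | quasi_prime op P]] (star_height op Q).
  by exists Q.
by rewrite y1 => /(le_trans h2).
Qed.

End Dimension.

End Theory.

(* [hK] excludes the degenerate case D^star = K (in particular D = K), in which
   D has no proper quasi-star-ideal: then (1) holds while the star_tilde-dimension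
   is 0, so that (2) and (3) fail. *)
Theorem theorem4p15 (D : idomainType)
    (star : set {fraction D} -> set {fraction D})
    (hstar : semistar star)
    (hK : star (base D) <> [set: {fraction D}]%classic) :
  [<-> star_DD star;
       [/\ star_noetherian (star_tilde star),
           star_dim (star_tilde star) = 1%E
         & quasi_integrally_closed (star_tilde star)];
       [/\ star_noetherian (star_tilde star),
           star_dim (star_tilde star) = 1%E
         & integrally_closed (star_tilde star (base D))]].
Proof.
tfae=> [[acc hPMD]|[acct dim1 qic]|[acct dim1 ic]].
- have teq := star_tilde_eq hstar hPMD.
  split; [exact: star_tilde_noetherian| |exact: star_tilde_quasi_integrally_closed].
  have [Q hQ] := quasi_max_ex hstar hK.
  apply: (star_dim1 (quasi_max_quasi_prime hstar hQ)) => P P' [pP [[fP _] _]] [pP' [[fP' P'B] P'E]] PP'.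
  (* As t = f, P' is a quasi-f-ideal and lies in some M of M(f), to which P and P' are then both
     equal. *)
  have [|M hM P'M] := @quasi_max_above _ _ hstar P'.
    split; first by split=> //; rewrite -teq.
    by move=> eP'; case: pP' => _ + _; rewrite eP' => /properxx.
  have below := prime_below_quasi_max hstar acc hPMD hM.
  by rewrite (below P pP fP (subset_trans PP' P'M)) (below P').
- by split=> //; apply: integrally_closed_star_tilde.
have incomp P Q := @star_dim1_incomparable _ _ P Q dim1.
by split; [exact: star_noetherian_of_tilde|exact: PstarMD_of_tilde].
Qed.
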